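(* Let $\nu>\frac12$ and let $m$ be an integer with $0\le m\le\lfloor\nu-\frac12\rfloor$. For $z\in\mathbb{C}$ with $|z|<1$, let $X_{m,z}$ be a random variable distributed according to the generalized negative binomial distribution of parameters $(\nu,\tau,m)$ with $\tau=|z|^2$, and let $Q(X_{m,z})$ be its Mandel parameter. Then there exists a nonnegative real number $\rho=\rho(\nu,m)$ such that for every $z$ with $|z|<1$ and $\mathbb{E}(X_{m,z})\neq 0$: (i) if $|z|<\rho$, then the photon counting statistics are sub-Poissonian, i.e. $Q(X_{m,z})<0$; (ii) if $|z|=\rho$, then they are Poissonian, i.e. $Q(X_{m,z})=0$; (iii) if $|z|>\rho$, then they are super-Poissonian, i.e. $Q(X_{m,z})>0$.
   Context: The Mandel parameter of a random variable $X$ with finite variance and nonzero mean is $Q(X)=\frac{\mathrm{Var}(X)}{\mathbb{E}(X)}-1$. The statistics are called sub-Poissonian if $Q<0$, Poissonian if $Q=0$, super-Poissonian if $Q>0$. Jacobi polynomials: for real $a,b>-1$, $P_n^{(a,b)}(x)=\sum_{k=0}^n\binom{n+a}{k}\binom{n+b}{n-k}\left(\frac{x-1}{2}\right)^{n-k}\left(\frac{x+1}{2}\right)^k$, with $\binom{c}{k}=\frac{c(c-1)\cdots(c-k+1)}{k!}$ for real $c$. Generalized negative binomial distribution of parameters $(\nu,\tau,m)$, $\tau=|z|^2\in[0,1)$: the probability distribution on $\{0,1,2,\dots\}$ with masses $$p_j^{(\nu,\tau,m)}:=\gamma_j^{(\nu,m)}(1-\tau)^{2\nu-2m}\,\tau^{|m-j|}\left(P_{\min(m,j)}^{(|m-j|,\,2\nu-2m-1)}(1-2\tau)\right)^2,$$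 with $\gamma_j^{(\nu,m)}=\frac{j!\,\Gamma(2\nu-m)}{m!\,\Gamma(2\nu-2m+j)}$ if $j\le m$, $\gamma_j^{(\nu,m)}=\frac{m!\,\Gamma(2\nu-2m+j)}{j!\,\Gamma(2\nu-m)}$ if $j\ge m$, and $0^0=1$. *)

(* Defs.v *)
From HB Require Import structures.
From mathcomp Require Import all_boot all_order all_algebra.
From mathcomp Require Import complex.
From mathcomp Require Import all_classical all_reals all_analysis.

Set Implicit Arguments.
Unset Strict Implicit.
Unset Printing Implicit Defensive.

Import Order.TTheory GRing.Theory Num.Theory.
Import numFieldNormedType.Exports.

Local Open Scope classical_set_scope.
Local Open Scope ring_scope.

(* The Euler integral; it is only used below at arguments [>= 1], where it
   converges. *)
Definition Gamma (R : realType) (x : R) : R :=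
  (\int[@lebesgue_measure R]_(t in `]0, +oo[) (t `^ (x - 1) * expR (- t)))%R.

Definition gbinom (R : realType) (c : R) (k : nat) : R :=
  (\prod_(i < k) (c - i%:R)) / k`!%:R.

Definition jacobi (R : realType) (n : nat) (a b x : R) : R :=
  \sum_(k < n.+1) gbinom (n%:R + a) k * gbinom (n%:R + b) (n - k)
    * ((x - 1) / 2) ^+ (n - k) * ((x + 1) / 2) ^+ k.

Definition gnb_gamma (R : realType) (nu : R) (m j : nat) : R :=
  if (j <= m)%N then
    (j`!%:R * Gamma (2 * nu - m%:R))
      / (m`!%:R * Gamma (2 * nu - 2 * m%:R + j%:R))
  else
    (m`!%:R * Gamma (2 * nu - 2 * m%:R + j%:R))
      / (j`!%:R * Gamma (2 * nu - m%:R)).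

(* The exponent [|m - j|] is a natural number and [0 ^+ 0 = 1]. *)
Definition gnb_pmf (R : realType) (nu tau : R) (m j : nat) : R :=
  let d := `|m%:Z - j%:Z|%N in
  gnb_gamma nu m j * (1 - tau) `^ (2 * nu - 2 * m%:R) * tau ^+ d
    * jacobi (minn m j) d%:R (2 * nu - 2 * m%:R - 1) (1 - 2 * tau) ^+ 2.

Definition gnb_distributed (R : realType) (d : measure_display)
    (T : measurableType d) (P : probability T R) (X : {RV P >-> nat})
    (nu tau : R) (m : nat) : Prop :=
  forall j : nat, distribution P X [set j] = (gnb_pmf nu tau m j)%:E.

(* Meaningful only when the variance is finite and the mean is nonzero. *)
Definition mandel (R : realType) (d : measure_display) (T : measurableType d)
    (P : probability T R) (X : T -> R) : R :=
  fine ('V_P[X])%E / fine ('E_P[X])%E - 1.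

(* Main.v *)
Require Import Defs.
From HB Require Import structures.
From mathcomp Require Import all_boot all_order all_algebra.
From mathcomp Require Import complex ring lra.
From mathcomp Require Import all_classical all_reals all_analysis.
From mathcomp Require Import measurable_realfun.

(** Write [B = 2 nu - 2 m], so that [B >= 1], and [c = tau].

    The mean and the variance of the distribution have closed forms:
    [E = (m + (B + m) c) / (1 - c)] and
    [V = c (2 m^2 + 2 m B + B) / (1 - c)^2].  Hence the Mandel parameter has the
    sign of [(1 - c)^2 (V - E) = (B + m) c^2 + 2 m (B + m) c - m], a quadratic
    polynomial in [c] with a single nonnegative root, negative before it and
    positive after it ([sg_mandel_numerator]); [rho] is the square root of that
    root.

    To find the moments, the masses are first rewritten ([gnb_pmf_meixner]) as
    [p_j = K w_j M(j)^2], where [w_j = (B)_j c^j / j!] and [M] is the Meixner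
    polynomial of degree [m].  The symmetry of Meixner polynomials in degree
    and argument makes this one formula valid on both sides of [j = m], and the
    functional equation [GammaS] of the Gamma function turns the Gamma
    quotients into Pochhammer symbols.

    The Meixner polynomial satisfies a second order difference equation in [j]
    ([meixner_difference]).  From it alone one finds polynomials [P] such that
    [(j - E) w_j M(j)^2] and [((j - E)^2 - V) w_j M(j)^2] are the differences
    of [w_j P(j)] ([meixner_telescoping]).  As [P(0) = 0] and [w_n P(n)] tends to
    zero ([cvg_weight_poly]), both series sum to zero; together with the total
    mass being one, this identifies the mean and the variance, including their
    finiteness. *)

Set Implicit Arguments.
Unset Strict Implicit.
Unset Printing Implicit Defensive.

Import Order.TTheory GRing.Theory Num.Theory.
Import numFieldNormedType.Exports.

Local Open Scope classical_set_scope.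
Local Open Scope ring_scope.

(** * Meixner polynomials and their telescoping identities *)

(** The Pochhammer symbol [(B)_k]. *)
Definition rising (R : realFieldType) (B : R) (k : nat) : R :=
  \prod_(i < k) (B + i%:R).

(** The unnormalised negative binomial weight, with respect to which the
    Meixner polynomials are orthogonal. *)
Definition weight (R : realFieldType) (B c : R) (j : nat) : R :=
  rising B j * c ^+ j / j`!%:R.

Definition ffact_poly (R : realFieldType) (k : nat) : {poly R} :=
  \prod_(i < k) ('X - i%:R%:P).

Definition meixner_coef (R : realFieldType) (B c : R) (m k : nat) : R :=
  'C(m, k)%:R * ((c - 1) / c) ^+ k / rising B k.

(** The Meixner polynomial [2F1(-m, -x; B; 1 - 1/c)] as a function of [x]. *)
Definition meixner (R : realFieldType) (B c : R) (m : nat) : {poly R} :=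
  \sum_(k < m.+1) meixner_coef B c m k *: ffact_poly R k.

Lemma rising_gt0 (R : realFieldType) (B : R) k : 0 < B -> 0 < rising B k.
Proof. by move=> B0; apply: prodr_gt0 => i _; rewrite ltr_wpDr. Qed.

Lemma risingS (R : realFieldType) (B : R) k :
  rising B k.+1 = rising B k * (B + k%:R).
Proof. by rewrite /rising big_ord_recr. Qed.

Lemma weightS (R : realFieldType) (B c : R) j :
  weight B c j.+1 * (j%:R + 1) = c * (B + j%:R) * weight B c j.
Proof.
have j0 : (j.+1%:R : R) != 0 by rewrite pnatr_eq0.
have f0 : (j`!%:R : R) != 0 by rewrite pnatr_eq0 -lt0n fact_gt0.
rewrite /weight risingS factS natrM exprS natr1.
by move: (j.+1%:R) j0 => x x0; field; rewrite f0 x0.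
Qed.

Lemma weight_gt0 (R : realFieldType) (B c : R) j :
  0 < B -> 0 < c -> 0 < weight B c j.
Proof.
by move=> B0 c0; rewrite /weight divr_gt0 ?mulr_gt0 ?rising_gt0 ?exprn_gt0 //
  ltr0n fact_gt0.
Qed.

Lemma horner_ffact_poly (R : realFieldType) (k : nat) (x : R) :
  (ffact_poly R k).[x] = \prod_(i < k) (x - i%:R).
Proof. by rewrite /ffact_poly horner_prod; apply: eq_bigr => i _; rewrite !hornerE. Qed.

Lemma ffact_polySr (R : realFieldType) k (x : R) :
  (ffact_poly R k.+1).[x] = (ffact_poly R k).[x] * (x - k%:R).
Proof. by rewrite !horner_ffact_poly big_ord_recr. Qed.

Lemma ffact_polySl (R : realFieldType) k (x : R) :
  (ffact_poly R k.+1).[x] = x * (ffact_poly R k).[x - 1].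
Proof.
rewrite !horner_ffact_poly big_ord_recl subr0; congr (_ * _).
by apply: eq_bigr => i _; rewrite /bump /= natrD opprD addrA.
Qed.

Lemma ffact_poly_nat (R : realFieldType) k (j : nat) :
  (ffact_poly R k).[j%:R] = (j ^_ k)%:R.
Proof.
elim: k j => [|k IHk] [|j]; rewrite ?ffactSS ?ffact0n.
- by rewrite horner_ffact_poly big_ord0.
- by rewrite horner_ffact_poly big_ord0.
- by rewrite ffact_polySl mul0r.
- by rewrite ffact_polySl -natr1 addrK IHk natr1 natrM.
Qed.

Lemma meixner_coefS (R : realFieldType) (B c : R) m k :
  0 < B -> c != 0 -> (k <= m)%N ->
  meixner_coef B c m k.+1 * (c * k.+1%:R * (B + k%:R)) =
  (m%:R - k%:R) * (c - 1) * meixner_coef B c m k.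
Proof.
move=> B0 c0 km; rewrite /meixner_coef risingS exprS.
have r0 : rising B k != 0 by rewrite gt_eqF ?rising_gt0.
have Bk : B + k%:R != 0 by rewrite gt_eqF // ltr_wpDr.
have : ('C(m, k.+1)%:R * k.+1%:R : R) = (m%:R - k%:R) * 'C(m, k)%:R.
  by rewrite -natrB // -!natrM mulnC mul_bin_left.
move: (_.+1%:R) => kS binE.
transitivity ('C(m, k.+1)%:R * kS * ((c - 1) * ((c - 1) / c) ^+ k / rising B k)).
  by field; rewrite ?c0 ?Bk ?r0.
by rewrite binE; field; rewrite ?c0 ?r0.
Qed.

(** The second order difference equation of the Meixner polynomials.  On the
    falling factorial [x^_k] the operator
    [c (x + B) (f (x + 1) - f x) - x (f x - f (x - 1))] acts as
    [x^_k |-> (c - 1) k x^_k + c k (B + k - 1) x^_(k - 1)]; the recurrence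
    [meixner_coefS] is what makes the polynomial an eigenvector for the
    eigenvalue [m (c - 1)]. *)
Lemma meixner_difference (R : realFieldType) (B c : R) m (x : R) :
  0 < B -> c != 0 ->
  c * (x + B) * (meixner B c m).[x + 1] + x * (meixner B c m).[x - 1] =
  ((1 + c) * x + c * B - m%:R * (1 - c)) * (meixner B c m).[x].
Proof.
move=> B0 c0; pose a := meixner_coef B c m; pose T k y := (ffact_poly R k).[y].
have ME y : (meixner B c m).[y] = \sum_(k < m.+1) a k * T k y.
  by rewrite /meixner horner_sum; apply: eq_bigr => k _; rewrite hornerZ.
have termE k : c * (x + B) * T k (x + 1) + x * T k (x - 1)
    - (c * (x + B) + x) * T k x
    = (c - 1) * k%:R * T k x + c * k%:R * (B + k%:R - 1) * T k.-1 x.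
  have down : x * T k (x - 1) = T k x * (x - k%:R).
    by rewrite /T -ffact_polySl ffact_polySr.
  case: k down => [|k] down /=.
    by rewrite /T !horner_ffact_poly !big_ord0; ring.
  have up : T k.+1 (x + 1) = (x + 1) * T k x by rewrite /T ffact_polySl addrK.
  by rewrite down up /T ffact_polySr -natr1; ring.
(* Reindexing the lowered terms turns the coefficient recurrence into the
   missing part of the eigenvalue. *)
have shift : \sum_(k < m.+1) a k * (c * k%:R * (B + k%:R - 1) * T k.-1 x)
    = \sum_(k < m.+1) a k * ((m%:R - k%:R) * (c - 1) * T k x).
  rewrite big_ord_recl big_ord_recr /= !(mulr0, mul0r) subrr add0r.
  rewrite !(mulr0, mul0r) addr0; apply: eq_bigr => k _.
  rewrite /bump /= add1n; have := meixner_coefS B0 c0 (ltnW (ltn_ord k)).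
  rewrite -/(a _) -/(a _) -natr1 => E.
  transitivity (a k.+1 * (c * (k%:R + 1) * (B + k%:R)) * T k x).
    by rewrite add0n; ring.
  by rewrite E; ring.
suff : c * (x + B) * (meixner B c m).[x + 1] + x * (meixner B c m).[x - 1]
   - (c * (x + B) + x) * (meixner B c m).[x]
   = m%:R * (c - 1) * (meixner B c m).[x].
  by move/eqP; rewrite subr_eq => /eqP ->; ring.
rewrite !ME !mulr_sumr -sumrN -!big_split /=.
transitivity (\sum_(k < m.+1) (a k * ((c - 1) * k%:R * T k x)
    + a k * (c * k%:R * (B + k%:R - 1) * T k.-1 x))).
  by apply: eq_bigr => k _; rewrite -mulrDr -termE; ring.
rewrite big_split /= shift -big_split /=.
by apply: eq_bigr => k _; ring.
Qed.

(** Summation by parts.  Put [A_j = w_j M(j)^2], [C_j = j w_j M(j) M(j - 1)] and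
    [L_j = c j (B + j - 1)].  The difference equation and its square give
    [C_j + C_(j+1) = beta(j) A_j] and
    [L_(j+1) A_(j+1) - L_j A_(j-1) = beta(j) (C_(j+1) - C_j)].
    Multiplying the latter by [f(j)] and summing by parts against the former
    leaves a multiple of [A_j] as soon as [g(x) + g(x + 1) = 2 f(x) beta(x)],
    the discrete antiderivative being
    [L_j (f(j - 1) A_j + f(j) A_(j-1)) - g(j) C_j].  It is [w_j] times a
    polynomial divisible by [j], hence vanishes at [0], and at infinity because
    [w_j] decays geometrically. *)
Lemma meixner_telescoping (R : realFieldType) (B c : R) m (f g : {poly R}) :
  0 < B -> c != 0 -> let M := meixner B c m in
  let beta x := (1 + c) * x + c * B - m%:R * (1 - c) in
  (forall x, g.[x] + g.[x + 1] = 2 * f.[x] * beta x) ->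
  exists P : {poly R}, P.[0] = 0 /\ forall j : nat, let x := j%:R in
    weight B c j.+1 * P.[j.+1%:R] - weight B c j * P.[x] =
    (c * (x + B) * (x + 1) * f.[x + 1] - c * x * (x + B - 1) * f.[x - 1]
       + f.[x] * beta x ^+ 2 - g.[x + 1] * beta x)
    * (weight B c j * M.[x] ^+ 2).
Proof.
move=> B0 c0 M beta gE.
pose dn (p : {poly R}) := p \Po ('X - 1%:P).
pose P : {poly R} := c *: ('X * ('X + (B - 1)%:P)) * dn f * M ^+ 2
  + 'X ^+ 2 * f * dn M ^+ 2 - g * 'X * M * dn M.
have PE x : P.[x] = x * (c * (x + (B - 1)) * f.[x - 1] * M.[x] ^+ 2
    + x * f.[x] * M.[x - 1] ^+ 2 - g.[x] * M.[x] * M.[x - 1]).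
  by rewrite /P /dn !(hornerD, hornerN, hornerM, hornerZ, hornerX, hornerC,
    horner_exp, horner_comp); ring.
exists P; split => [|j x]; first by rewrite PE mul0r.
rewrite !PE -[j.+1%:R]natr1 addrK -/x.
have rec := meixner_difference m x B0 c0; rewrite -/M -/(beta x) in rec.
have wS := weightS B c j; rewrite -/x in wS.
have gx : g.[x] = 2 * f.[x] * beta x - g.[x + 1] by rewrite -gE addrK.
rewrite {}gx; move: (weight B c j.+1) (weight B c j) wS => w' w wS.
move: (M.[x + 1]) (M.[x]) (M.[x - 1]) (beta x) rec => M1 M0 M_1 b rec.
transitivity (w * (f.[x] * (c * (x + B) * M1) ^+ 2
      + c * (B + x) * (x + 1) * f.[x + 1] * M0 ^+ 2
      - g.[x + 1] * (c * (x + B) * M1) * M0)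
   - w * (x * (c * (x + (B - 1)) * f.[x - 1] * M0 ^+ 2
    + x * f.[x] * M_1 ^+ 2
    - (2 * f.[x] * b - g.[x + 1]) * M0 * M_1))).
  congr (_ - _).
  transitivity (w' * (x + 1) * (c * (x + B) * f.[x] * M1 ^+ 2
    + (x + 1) * f.[x + 1] * M0 ^+ 2 - g.[x + 1] * M1 * M0)); first by ring.
  by rewrite wS; ring.
rewrite (_ : c * (x + B) * M1 = b * M0 - x * M_1); first by ring.
by rewrite -rec addrK.
Qed.

Definition gnb_mean (R : realFieldType) (B c : R) (m : nat) : R :=
  (m%:R + (B + m%:R) * c) / (1 - c).

Definition gnb_variance (R : realFieldType) (B c : R) (m : nat) : R :=
  c * (2 * m%:R ^+ 2 + 2 * m%:R * B + B) / (1 - c) ^+ 2.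

(** A constant [f] turns the factor of [meixner_telescoping] into an affine
    function of [j], whose zero has to be the mean. *)
Lemma mean_telescoping (R : realFieldType) (B c : R) m :
  0 < B -> 0 < c < 1 -> exists P : {poly R}, P.[0] = 0 /\ forall j : nat,
    weight B c j.+1 * P.[j.+1%:R] - weight B c j * P.[j%:R] =
    (j%:R - gnb_mean B c m) * (weight B c j * (meixner B c m).[j%:R] ^+ 2).
Proof.
move=> B0 /andP[c0 c1].
have c1' : 1 - c != 0 by rewrite subr_eq0 gt_eqF.
pose a := - 2 / (1 - c) ^+ 2; pose b := c * B - m%:R * (1 - c).
have [|P [P0 PE]] := @meixner_telescoping _ B c m a%:P
    (a *: ((1 + c) *: 'X + (b - (1 + c) / 2)%:P)) B0 (lt0r_neq0 c0).
  by move=> x; rewrite !(hornerD, hornerZ, hornerX, hornerC) /b; field.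
exists P; split => // j; rewrite PE; congr (_ * _).
by rewrite !(hornerD, hornerZ, hornerX, hornerC) /b /a /gnb_mean; field.
Qed.

(** An affine [f] turns the factor of [meixner_telescoping] into a quadratic
    polynomial in [j], normalised here to have leading coefficient 1 and
    critical point the mean; its constant term gives the variance. *)
Lemma variance_telescoping (R : realFieldType) (B c : R) m :
  0 < B -> 0 < c < 1 -> exists P : {poly R}, P.[0] = 0 /\ forall j : nat,
    weight B c j.+1 * P.[j.+1%:R] - weight B c j * P.[j%:R] =
    ((j%:R - gnb_mean B c m) ^+ 2 - gnb_variance B c m)
    * (weight B c j * (meixner B c m).[j%:R] ^+ 2).
Proof.
move=> B0 /andP[c0 c1].
have c1' : 1 - c != 0 by rewrite subr_eq0 gt_eqF.
have s0 : 1 + c != 0 by rewrite gt_eqF // ltr_wpDl.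
pose s := 1 + c; pose b := c * B - m%:R * (1 - c).
(* For [f = beta] the factor is a quadratic polynomial [q] with leading
   coefficient [- s (1 - c)^2], and [k = q'(mu)] at the mean [mu]; a constant
   [f = d] contributes [- d (1 - c)^2 / 2 * (x - mu)], which [d] matches
   against [a k (x - mu)]. *)
pose a := - ((1 - c) ^+ 2 * s)^-1.
pose k := (c * (s * B + 2 * b) + 2 * s * c * B - 2 * s ^+ 2 * b
           - 2 * s * (1 - c) ^+ 2 * gnb_mean B c m).
pose d := 2 * a * k / (1 - c) ^+ 2.
pose beta : {poly R} := s *: 'X + b%:P.
have [|P [P0 PE]] := @meixner_telescoping _ B c m (a *: beta + d%:P)
    (a *: (beta * (beta - s%:P)) + d *: (beta - (s / 2)%:P)) B0 (lt0r_neq0 c0).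
  move=> x; rewrite !(hornerD, hornerZ, hornerX, hornerC, hornerN, hornerM).
  by rewrite /b /s; field.
exists P; split => // j; rewrite PE; congr (_ * _).
rewrite !(hornerD, hornerZ, hornerX, hornerC, hornerN, hornerM).
rewrite /d /k /a /gnb_variance /gnb_mean /b /s; field.
by rewrite ?c1' ?s0.
Qed.

(** * Functional equation of the Gamma function *)

Definition euler_integrand (R : realType) (a t : R) : R := t `^ a * expR (- t).

Lemma euler_integrand_ge0 (R : realType) (a t : R) : 0 <= euler_integrand a t.
Proof. by rewrite mulr_ge0 ?powR_ge0 ?expR_ge0. Qed.

(** The right-hand side is [C] times the exponential density of rate [1/2], so
    that one bound gives both integrability and decay at infinity.  It comes
    from [ln t <= t / K + ln K] with [K = 2 (a + 1)]. *)
Lemma euler_integrand_le (R : realType) (a : R) : 0 <= a ->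
  exists2 C, 0 <= C & forall t, 0 < t ->
    euler_integrand a t <= C * (2^-1 * expR (- 2^-1 * t)).
Proof.
move=> a0; pose K := 2 * (a + 1).
have K0 : 0 < K by rewrite mulr_gt0 // ltr_wpDl.
exists (2 * expR (a * ln K)) => [|t t0]; first by rewrite mulr_ge0 ?expR_ge0.
have lnt : ln t <= t / K + ln K.
  rewrite -lerBlDr -ln_div ?posrE //.
  have tK : 0 < t / K by rewrite divr_gt0.
  have := le_ln1Dx (_ : -1 < t / K - 1).
  rewrite [X in ln X](_ : _ = t / K); last by ring.
  move=> h; apply: (le_trans (h _)); last by rewrite gerBl.
  by rewrite ltrBrDr addNr.
rewrite (_ : 2 * expR (a * ln K) * (2^-1 * expR (- 2^-1 * t))
  = expR (a * ln K + t / 2) * expR (- t)); last first.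
  by rewrite mulrACA divff // mul1r -!expRD; congr expR; field.
rewrite /euler_integrand ler_pM2r ?expR_gt0 // /powR gt_eqF // ler_expR.
apply: (le_trans (ler_wpM2l a0 lnt)); rewrite mulrDr addrC lerD2l.
rewrite mulrCA ler_pM2l // ler_pdivrMr // /K; lra.
Qed.

Lemma cvg_expR_halfN (R : realType) :
  expR (- 2^-1 * t) @[t --> +oo] --> (0 : R).
Proof.
rewrite (_ : (fun x => expR (- 2^-1 * x)) =
             (fun z => expR (- z)) \o (fun z => 2^-1 * z)); last first.
  by apply: eq_fun => x; rewrite mulNr.
apply: (@cvg_comp _ _ _ _ _ _ (pinfty_nbhs R)); last exact: cvgr_expR.
exact: gt0_cvgMry.
Qed.

Lemma cvg_euler_integrand (R : realType) (a : R) : 0 <= a ->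
  euler_integrand a t @[t --> +oo] --> (0 : R).
Proof.
move=> /euler_integrand_le[C C0 le_C].
apply: (@squeeze_cvgr _ _ _ _ (cst 0) (fun t => C * (2^-1 * expR (- 2^-1 * t)))).
- near=> t; rewrite /= euler_integrand_ge0 /= le_C //.
- exact: cvg_cst.
- rewrite -[0](_ : C * (2^-1 * 0) = 0); last by rewrite !mulr0.
  by do 2 apply: cvgMr; exact: cvg_expR_halfN.
Unshelve. all: by end_near. Qed.

Lemma is_derive_euler_integrand (R : realType) (a t : R) : 0 < t ->
  is_derive t 1 (euler_integrand a)
    (a * euler_integrand (a - 1) t - euler_integrand a t).
Proof.
move=> t0; have ? := is_derive1_powR a t0.
apply: is_derive_eq; rewrite /euler_integrand /GRing.scale /=; ring.
Qed.

Lemma continuous_euler_integrand (R : realType) (a : R) : 0 <= a ->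
  {within `[0, +oo[, continuous (@euler_integrand R a)}.
Proof.
move=> a0; apply/continuous_within_itvcyP; split.
  move=> t; rewrite in_itv /= andbT => t0.
  have [dF _] := is_derive_euler_integrand a t0.
  exact/differentiable_continuous/derivable1_diffP.
apply: cvgM.
  move: a0; rewrite le_eqVlt => /predU1P[<-|a0].
    rewrite powRr0; under eq_fun do rewrite powRr0; exact: cvg_cst.
  by rewrite powR0 ?gt_eqF //; exact: powR_cvg0.
apply: cvg_at_right_filter.
by apply: continuous_comp; [exact: opp_continuous | exact: continuous_expR].
Qed.


Lemma integrable_euler_integrand (R : realType) (a : R) : 0 <= a ->
  lebesgue_measure.-integrable `]0, +oo[ (EFin \o @euler_integrand R a).
Proof.
move=> a0; have [C C0 le_C] := euler_integrand_le a0.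
have half0 : 0 < 2^-1 :> R by rewrite invr_gt0.
have mD : measurable (`]0, +oo[ : set R) by [].
have := @le_integrable _ _ R lebesgue_measure _ mD (EFin \o @euler_integrand R a)
  (fun t => (C%:E * (exponential_pdf 2^-1 t)%:E)%E).
apply.
- apply/measurable_EFinP; apply: subspace_continuous_measurable_fun.
    exact: measurable_itv.
  apply: continuous_subspaceW (continuous_euler_integrand a0).
  by move=> t /=; rewrite !in_itv /= !andbT => /ltW.
- move=> t; rewrite /= in_itv /= andbT => t0.
  rewrite lee_fin ger0_norm ?euler_integrand_ge0 //.
  apply: (le_trans (le_C _ t0)); rewrite exponential_pdfE; last exact: ltW.
  exact: ler_norm.
- apply: integrableZl; first exact: measurable_itv.
  apply: integrableS (integrable_exponential_pdf half0) => //.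
Qed.

Lemma GammaE (R : realType) (x : R) :
  Gamma x = \int[lebesgue_measure]_(t in `]0, +oo[) euler_integrand (x - 1) t.
Proof. by []. Qed.

Lemma Gamma_gt0 (R : realType) (x : R) : 1 <= x -> 0 < Gamma x.
Proof.
move=> x1; rewrite GammaE.
have a0 : 0 <= x - 1 by rewrite subr_ge0.
have int := integrable_euler_integrand a0.
have sub12 : `[1, 2] `<=` (`]0, +oo[ : set R).
  by move=> t /=; rewrite !in_itv /= andbT => /andP[/(lt_le_trans ltr01)].
apply: (@lt_le_trans _ _ (\int[lebesgue_measure]_(t in `[1, 2]) expR (-2 : R))).
  rewrite Rintegral_cst //= lebesgue_measure_itv /= lte_fin ltr1n /=.
  by rewrite mulr_gt0 ?expR_gt0 //; lra.
apply: (@le_trans _ _ (\int[lebesgue_measure]_(t in `[1, 2]) euler_integrand (x - 1) t)).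
  apply: le_Rintegral => //.
  - apply: continuous_compact_integrable; first exact: segment_compact.
    exact: cst_continuous.
  - apply: integrableS int => //; exact: sub12.
  - move=> t; rewrite /= in_itv /= => /andP[t1 t2].
    have : 1 `^ (x - 1) <= t `^ (x - 1).
      by apply: (ge0_ler_powR a0); rewrite ?nnegrE ?(le_trans ler01).
    rewrite powR1 => t1'.
    by rewrite -[leLHS]mul1r ler_pM ?expR_ge0 // ler_expR lerN2.
have [mint _] := integrableP _ _ _ int.
rewrite /Rintegral fine_le ?integrable_fin_num //.
  by apply: integrableS int => //; exact: sub12.
by apply: ge0_subset_integral => // t _; rewrite lee_fin euler_integrand_ge0.
Qed.

(** The derivative of [t^x e^(-t)] is [x t^(x-1) e^(-t) - t^x e^(-t)], and its
    integral over the half-line is zero.  Splitting at [x], where the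
    derivative changes sign, makes the fundamental theorem of calculus for
    functions of constant sign applicable on the unbounded part. *)
Lemma GammaS (R : realType) (x : R) : 1 <= x -> Gamma (x + 1) = x * Gamma x.
Proof.
move=> x1; have x0 : 0 < x by rewrite (lt_le_trans _ x1).
have a0 : 0 <= x - 1 by rewrite subr_ge0.
pose F := @euler_integrand R x.
pose f t := x * euler_integrand (x - 1) t - F t.
have cf : {within `[0, +oo[, continuous f}.
  move=> t; apply: cvgB; last exact: (continuous_euler_integrand (ltW x0)).
  by apply: cvgMr; exact: (continuous_euler_integrand a0).
have dF (t : R) : 0 < t -> is_derive t 1 F (f t).
  exact: is_derive_euler_integrand.
have cF (t : R) : 0 < t -> {for t, continuous F}.
  by move=> /dF[? _]; exact/differentiable_continuous/derivable1_diffP.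
have F'E (t : R) : 0 < t -> derive1 F t = f t.
  by move=> /dF[? dE]; rewrite derive1E dE.
have fE (t : R) : 0 < t -> f t = t `^ (x - 1) * expR (- t) * (x - t).
  move=> t0; rewrite /f /F /euler_integrand -(mulr_powRB1 (ltW t0) x0); ring.
have h_int := integrable_euler_integrand a0.
have F_int := integrable_euler_integrand (ltW x0).
have xh_int : lebesgue_measure.-integrable `]0, +oo[
    (EFin \o (fun t => x * euler_integrand (x - 1) t)).
  by apply: (@integrableZl _ _ R lebesgue_measure _ _ x
    (EFin \o euler_integrand (x - 1))).
have f_int : lebesgue_measure.-integrable `]0, +oo[ (EFin \o f).
  by apply: (@integrableB _ _ R lebesgue_measure _ _
    (EFin \o (fun t => x * euler_integrand (x - 1) t)) (EFin \o F)).
have F0 : F 0 = 0 by rewrite /F /euler_integrand powR0 ?mul0r ?gt_eqF.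
have below : \int[lebesgue_measure]_(t in `]0, x[) f t = F x.
  rewrite Rintegral_itv_bndo_bndc; last first.
    by apply: integrableS f_int => // t /=; rewrite !in_itv /= andbT => /andP[].
  rewrite Rintegral_itv_obnd_cbnd; last first.
    by apply: integrableS f_int => // t /=; rewrite !in_itv /= andbT => /andP[].
  rewrite /Rintegral (@continuous_FTC2 _ f F) ?F0 ?sube0 //.
  - by apply: continuous_subspaceW cf => t /=; rewrite !in_itv /= andbT => /andP[].
  - split.
    + by move=> t; rewrite in_itv /= => /andP[/dF[]].
    + by have /continuous_within_itvcyP[] := continuous_euler_integrand (ltW x0).
    + exact/cvg_at_left_filter/cF.
  - by move=> t; rewrite in_itv /= => /andP[/F'E].
have above : \int[lebesgue_measure]_(t in `[x, +oo[) f t = - F x.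
  rewrite /Rintegral (@le0_continuous_FTC2y _ f F _ 0) ?sub0e //.
  - move=> t xt; have t0 := lt_le_trans x0 xt.
    by rewrite fE // mulr_ge0_le0 ?subr_le0 // mulr_ge0 ?powR_ge0 ?expR_ge0.
  - apply: continuous_subspaceW cf => t /=; rewrite !in_itv /= !andbT.
    exact: (le_trans (ltW x0)).
  - exact: cvg_euler_integrand (ltW x0).
  - exact/cvg_at_right_filter/cF.
  - by move=> t xt; have [] := dF t (lt_trans x0 xt).
  - by move=> t; rewrite in_itv /= andbT => xt; exact: F'E (lt_trans x0 xt).
have : \int[lebesgue_measure]_(t in `]0, +oo[) f t = 0.
  have -> : `]0, +oo[%classic = `]0, x[%classic `|` `[x, +oo[%classic :> set R.
    by rewrite -itv_bndbnd_setU // bnd_simp.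
  rewrite Rintegral_setU //= ?below ?above ?subrr //.
    by rewrite -itv_bndbnd_setU // bnd_simp.
  apply/disj_setPS => t /= []; rewrite !in_itv /= andbT => /andP[_ tx].
  by rewrite leNgt tx.
rewrite RintegralB // RintegralZl // -!GammaE => /eqP.
rewrite subr_eq0 => /eqP ->; rewrite GammaE addrK //.
Qed.

Lemma Gamma_rising (R : realType) (B : R) k : 1 <= B ->
  Gamma (B + k%:R) = Gamma B * rising B k.
Proof.
move=> B1; elim: k => [|k IHk]; first by rewrite addr0 /rising big_ord0 mulr1.
rewrite -natr1 addrA GammaS ?IHk; last by rewrite ler_wpDr.
by rewrite risingS; ring.
Qed.

(** * From Jacobi to Meixner polynomials *)

Lemma fact_neq0 (R : realFieldType) k : (k`!%:R : R) != 0.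
Proof. by rewrite pnatr_eq0 -lt0n fact_gt0. Qed.

Lemma gbinom_nat (R : realType) (l k : nat) :
  gbinom (l%:R : R) k = 'C(l, k)%:R.
Proof.
rewrite /gbinom -horner_ffact_poly ffact_poly_nat -bin_ffact natrM mulfK //.
Qed.

Lemma gbinom_rising (R : realType) (B : R) (n k : nat) : 0 < B -> (k <= n)%N ->
  gbinom (n%:R + (B - 1)) (n - k) = rising B n / (rising B k * (n - k)`!%:R).
Proof.
move=> B0 kn; rewrite /gbinom invfM mulrA; congr (_ / _).
apply: (mulIf (lt0r_neq0 (rising_gt0 k B0))).
rewrite mulfVK ?lt0r_neq0 ?rising_gt0 //.
move: (subnK kn); move: (n - k)%N => d <- {kn n}.
elim: d => [|d IHd]; first by rewrite big_ord0 mul1r add0n.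
rewrite big_ord_recl addSn risingS -IHd /= -natr1 -mulrA mulrC -mulrA [RHS]mulrAC -mulrA.
congr (_ * _); last by ring.
by apply: eq_bigr => i _; rewrite /bump /= add1n -natr1; ring.
Qed.

Lemma horner_meixner_nat (R : realFieldType) (B c : R) (m j N : nat) : (m < N)%N ->
  (meixner B c m).[j%:R] =
  \sum_(k < N) 'C(m, k)%:R * 'C(j, k)%:R * k`!%:R
    * ((c - 1) / c) ^+ k / rising B k.
Proof.
move=> mN; rewrite /meixner horner_sum.
rewrite (big_ord_widen N (fun k => (meixner_coef B c m k *: ffact_poly R k).[j%:R])) //.
rewrite big_mkcond; apply: eq_bigr => k _; case: ltnP => [_|mk].
  by rewrite hornerZ ffact_poly_nat -bin_ffact natrM /meixner_coef; ring.
by rewrite bin_small // !mul0r.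
Qed.

(** The expansion in [horner_meixner_nat] is symmetric in the degree and the
    argument; this is what merges the cases [j <= m] and [m <= j] of the
    mass function. *)
Lemma meixner_duality (R : realFieldType) (B c : R) (m j : nat) :
  (meixner B c m).[j%:R] = (meixner B c j).[m%:R].
Proof.
rewrite (horner_meixner_nat B c j (leq_addr j m.+1)).
rewrite (horner_meixner_nat B c m (_ : j < m.+1 + j)%N) ?addSn ?ltnS ?leq_addl //.
by apply: eq_bigr => k _; rewrite ['C(m, k)%:R * _]mulrC.
Qed.

(** At a natural first parameter [d], the coefficient [gbinom (n + d) k] is an
    ordinary binomial coefficient, so the Jacobi sum is termwise the Meixner
    polynomial of degree [n] evaluated at [n + d]. *)
Lemma jacobi_meixner (R : realType) (B c : R) (n d : nat) : 0 < B -> c != 0 ->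
  jacobi n d%:R (B - 1) (1 - 2 * c) =
  rising B n / n`!%:R * (- c) ^+ n * (meixner B c n).[(n + d)%:R].
Proof.
move=> B0 c0; rewrite (horner_meixner_nat B c (n + d) (ltnSn n)) mulr_sumr.
apply: eq_bigr => k _; have kn : (k <= n)%N by rewrite -ltnS.
rewrite -natrD gbinom_nat gbinom_rising //.
have -> : (1 - 2 * c - 1) / 2 = - c by field.
have -> : (1 - 2 * c + 1) / 2 = 1 - c by field.
have -> : (- c) ^+ n = (- c) ^+ (n - k) * (- c) ^+ k by rewrite -exprD subnK.
have -> : 'C(n, k)%:R = n`!%:R / (k`!%:R * (n - k)`!%:R) :> R.
  by rewrite -(bin_fact kn) !natrM mulfK // mulf_neq0 ?fact_neq0.
have -> : ((c - 1) / c) ^+ k = (1 - c) ^+ k / (- c) ^+ k.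
  by rewrite -expr_div_n; congr (_ ^+ _); field.
have rk := lt0r_neq0 (rising_gt0 k B0).
have ck : (- c) ^+ k != 0 by rewrite expf_neq0 // oppr_eq0.
have [[f1 f2] f3] := (fact_neq0 R n, fact_neq0 R k, fact_neq0 R (n - k)).
move: (rising B k) ((- c) ^+ k) (n`!%:R : R) (k`!%:R : R) ((n - k)`!%:R : R)
  rk ck f1 f2 f3 => r1 r2 r3 r4 r5 rk ck f1 f2 f3.
by field; rewrite ?rk ?ck ?f1 ?f2 ?f3.
Qed.

(** The mass function is, up to a factor independent of [j], the Meixner weight
    times a squared Meixner polynomial. *)
Lemma gnb_pmf_meixner (R : realType) (nu c : R) (m j : nat) :
  let B := 2 * nu - 2 * m%:R in
  0 < B -> c != 0 -> (forall k, Gamma (B + k%:R) = Gamma B * rising B k) ->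
  Gamma B != 0 ->
  gnb_pmf nu c m j = rising B m * c ^+ m * (1 - c) `^ B / m`!%:R
    * (weight B c j * (meixner B c m).[j%:R] ^+ 2).
Proof.
move=> B B0 c0 GE G0; rewrite /gnb_pmf /gnb_gamma -/B /weight.
have -> : 2 * nu - m%:R = B + m%:R by rewrite /B; ring.
rewrite !GE.
have [rm rj] := (lt0r_neq0 (rising_gt0 m B0), lt0r_neq0 (rising_gt0 j B0)).
have [fm fj] := (fact_neq0 R m, fact_neq0 R j).
have sqrE k : ((- c) ^+ k) ^+ 2 = c ^+ k * c ^+ k :> R.
  by rewrite exprAC sqrrN exprAC expr2.
case: leqP => [jm|/ltnW mj].
  have -> : `|m%:Z - j%:Z|%N = (m - j)%N by rewrite distnEl.
  rewrite jacobi_meixner // subnKC // [in LHS]meixner_duality.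
  have -> : c ^+ m = c ^+ (m - j) * c ^+ j by rewrite -exprD subnK.
  rewrite !exprMn sqrE.
  by field; rewrite ?G0 ?rm ?rj ?fm ?fj.
have -> : `|m%:Z - j%:Z|%N = (j - m)%N by rewrite distnEr.
rewrite jacobi_meixner // subnKC //.
have -> : c ^+ j = c ^+ (j - m) * c ^+ m by rewrite -exprD subnK.
rewrite !exprMn sqrE.
by field; rewrite ?G0 ?rm ?rj ?fm ?fj.
Qed.

(** * Limits and expectations of natural-valued random variables *)

Lemma cvg0_ratio (R : realType) (u r : R^nat) (l : R) :
  (forall n, 0 <= u n) -> (forall n, u n.+1 = r n * u n) ->
  0 <= l < 1 -> r @ \oo --> l -> u @ \oo --> (0 : R).
Proof.
move=> u0 uS /andP[l0 l1] rl.
pose q := (l + 1) / 2; have lq : l < q by rewrite /q; lra.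
have q1 : `|q| < 1 by rewrite ger0_norm /q; lra.
have [N _ rq] : \forall n \near \oo, r n <= q by apply: cvgr_le rl _ lq.
rewrite -(cvg_shiftn N).
apply: (@squeeze_cvgr _ _ _ _ (cst 0) (geometric (u N) q)).
- apply: nearW => n; rewrite u0 /=; elim: n => [|n IHn].
    by rewrite add0n expr0 mulr1.
  rewrite addSn uS exprS mulrCA (@le_trans _ _ (q * u (n + N)%N)) //.
    by rewrite ler_wpM2r // rq //= leq_addl.
  by rewrite ler_wpM2l // /q; lra.
- exact: cvg_cst.
- exact: cvg_geometric.
Qed.

Lemma cvg_ratio_pow (R : realType) (r : nat) :
  ((n.+2%:R / n.+1%:R) ^+ r : R) @[n --> \oo] --> (1 : R).
Proof.
elim: r => [|r IHr]; first by under eq_fun do rewrite expr0; exact: cvg_cst.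
under eq_fun do rewrite exprS.
suff lim1 : (n.+2%:R / n.+1%:R : R) @[n --> \oo] --> (1 : R).
  by have h := cvgM lim1 IHr; rewrite mulr1 in h; exact: h.
rewrite (_ : (fun _ => _) = (fun n => 1 + harmonic n)); last first.
  by apply/funext => n; rewrite -natr1 mulrDl divff ?pnatr_eq0 // mul1r.
have := cvgD (cvg_cst (1 : R)) (@cvg_harmonic R); rewrite addr0; exact.
Qed.

(** Ratio test: consecutive terms have a ratio tending to [c < 1]. *)
Lemma cvg_weight_pow (R : realType) (B c : R) (r : nat) :
  0 < B -> 0 < c < 1 -> (weight B c n * n.+1%:R ^+ r) @[n --> \oo] --> (0 : R).
Proof.
move=> B0 /andP[c0 c1].
apply: (@cvg0_ratio _ _
  (fun n => c * (1 + (B - 1) * n.+1%:R^-1) * (n.+2%:R / n.+1%:R) ^+ r) c).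
- by move=> n; rewrite mulr_ge0 ?exprn_ge0 // ltW // weight_gt0.
- move=> n; have n0 : n.+1%:R != 0 :> R by rewrite pnatr_eq0.
  have -> : weight B c n.+1 = c * (B + n%:R) * weight B c n / n.+1%:R.
    by rewrite -weightS natr1 mulfK.
  rewrite expr_div_n.
  have -> : B + n%:R = n.+1%:R + (B - 1) by rewrite -natr1; ring.
  have := expf_neq0 r n0.
  by move: (n.+1%:R : R) (n.+1%:R ^+ r) n0 => x p n0 p0; field; rewrite ?p0 ?n0.
- by rewrite ltW.
- have h1 : (1 + (B - 1) * n.+1%:R^-1) @[n --> \oo] --> (1 + (B - 1) * 0).
    by apply: cvgD; [exact: cvg_cst | apply: cvgMr; exact: cvg_harmonic].
  have h2 := cvgM (cvgM (cvg_cst c) h1) (@cvg_ratio_pow R r).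
  by rewrite mulr0 addr0 !mulr1 in h2; exact: h2.
Qed.

Lemma cvg_weight_poly (R : realType) (B c : R) (P : {poly R}) :
  0 < B -> 0 < c < 1 -> (weight B c n * P.[n%:R]) @[n --> \oo] --> (0 : R).
Proof.
move=> B0 c01.
suff H r : (weight B c n * n.+1%:R ^+ r * P.[n%:R]) @[n --> \oo] --> (0 : R).
  by under eq_fun => n do rewrite -[weight B c n]mulr1 -(expr0 n.+1%:R); exact: (H 0%N).
(* The factor [n.+1^r] absorbs the multiplications by ['X], as [n = (n + 1) - 1]. *)
elim/poly_ind: P r => [|P a IHP] r.
  by under eq_fun do rewrite horner0 mulr0; exact: cvg_cst.
rewrite (_ : (fun _ => _) = (fun n => weight B c n * n.+1%:R ^+ r.+1 * P.[n%:R]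
   - weight B c n * n.+1%:R ^+ r * P.[n%:R] + a * (weight B c n * n.+1%:R ^+ r))).
  have h := cvgD (cvgB (IHP r.+1) (IHP r))
    (cvgM (cvg_cst a) (cvg_weight_pow r B0 c01)).
  by rewrite mulr0 addr0 subr0 in h; exact: h.
by apply/funext => n; rewrite hornerMXaddC exprSr -[n.+1%:R]natr1; ring.
Qed.

Lemma ge0_expectation_nat d (T : measurableType d) (R : realType)
    (P : probability T R) (X : {RV P >-> nat}) (p f : nat -> R) :
  (forall j, distribution P X [set j] = (p j)%:E) -> (forall j, 0 <= f j) ->
  ('E_P[fun t => f (X t)] = \sum_(0 <= j <oo) (f j * p j)%:E)%E.
Proof.
move=> Xp f0; rewrite unlock.
have mXj j : measurable (X @^-1` [set j]) by exact: measurable_funPTI.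
have mf : measurable_fun [set: nat] (EFin \o f) by [].
have -> : setT = \bigcup_j (X @^-1` [set j]).
  by apply/seteqP; split => // t _; exists (X t).
rewrite ge0_integral_bigcup //=.
- apply: eq_eseriesr => j _.
  rewrite (eq_integral (cst (f j)%:E)); last first.
    by move=> t; rewrite inE /= => ->.
  by rewrite integral_cst // EFinM -Xp.
- apply: measurable_funTS; apply: (measurableT_comp mf); exact: measurable_funP.
- by move=> t _; rewrite lee_fin.
- exact: trivIset_preimage1.
Qed.

Lemma expectation_nat_cvg d (T : measurableType d) (R : realType)
    (P : probability T R) (X : {RV P >-> nat}) (p f : nat -> R) (l : R) :
  (forall j, distribution P X [set j] = (p j)%:E) -> (forall j, 0 <= f j) ->
  (\sum_(0 <= j < n) f j * p j) @[n --> \oo] --> l ->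
  ('E_P[fun t => f (X t)] = l%:E)%E.
Proof.
move=> Xp f0 fl; rewrite (ge0_expectation_nat Xp f0); apply/cvg_lim => //.
under eq_fun do rewrite sumEFin.
by apply: cvg_EFin => //; exact: nearW.
Qed.

Lemma cvg_sum_pmf d (T : measurableType d) (R : realType)
    (P : probability T R) (X : {RV P >-> nat}) (p : nat -> R) :
  (forall j, distribution P X [set j] = (p j)%:E) ->
  (\sum_(0 <= j < n) p j) @[n --> \oo] --> (1 : R).
Proof.
move=> Xp; have p0 j : 0 <= p j by rewrite -lee_fin -Xp measure_ge0.
have /= := ge0_expectation_nat Xp (fun=> @ler01 R).
rewrite unlock integral_cst // mul1e => h1.
have {h1} sum1 := etrans (esym h1) (probability_setT P).
have : (\sum_(0 <= j < n) (1 * p j)%:E)%E @[n --> \oo] --> (1%:E : \bar R).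
  rewrite -sum1; apply: is_cvg_nneseries => j _ _.
  by rewrite lee_fin mul1r.
under eq_fun do rewrite sumEFin.
move=> /fine_cvg h; apply: cvg_trans h; apply: near_eq_cvg; apply: nearW => n /=.
by apply: eq_bigr => j _; rewrite mul1r.
Qed.

(** How an antiderivative [u] of [(f - l) A] computes the [A]-mean of [f]: the
    partial sums of [f A] and of [l A] differ by [u n], so that the convergence
    of the former follows. *)
Lemma cvg_sum_telescoping (R : realType) (u A f : nat -> R) (l : R) :
  u 0%N = 0 -> u @ \oo --> (0 : R) ->
  (forall j, u j.+1 - u j = (f j - l) * A j) ->
  (\sum_(0 <= j < n) A j) @[n --> \oo] --> (1 : R) ->
  (\sum_(0 <= j < n) f j * A j) @[n --> \oo] --> l.
Proof.
move=> u0 ul uS A1.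
have E n : \sum_(0 <= j < n) f j * A j = l * (\sum_(0 <= j < n) A j) + u n.
  have -> : u n = \sum_(0 <= j < n) (u j.+1 - u j).
    by rewrite telescope_sumr // u0 subr0.
  rewrite mulr_sumr -big_split /=.
  by apply: eq_bigr => j _; rewrite uS; ring.
rewrite (_ : (fun _ => _) = (fun n => l * (\sum_(0 <= j < n) A j) + u n)); last first.
  exact/funext.
have h := cvgD (cvgM (cvg_cst l) A1) ul.
by rewrite mulr1 addr0 in h; exact: h.
Qed.

(** * Moments and the sign of the Mandel parameter *)

(** At the vacuum parameter [tau = 0] the distribution is a point mass, a case
    apart because the Meixner polynomials involve [1 / c]. *)
Lemma gnb_pmf_tau0 (R : realType) (nu : R) (m j : nat) :
  j != m -> gnb_pmf nu 0 m j = 0.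
Proof.
move=> jm; rewrite /gnb_pmf expr0n.
by rewrite absz_eq0 subr_eq0 eqz_nat eq_sym (negbTE jm) mulr0 mul0r.
Qed.

(** The normalising factor drops out because the masses sum to one. *)
Lemma gnb_cvg_expectation d (T : measurableType d) (R : realType)
    (P : probability T R) (X : {RV P >-> nat}) (nu c : R) (m : nat)
    (f : nat -> R) (l : R) (Q : {poly R}) :
  let B := 2 * nu - 2 * m%:R in
  1 <= B -> 0 < c < 1 -> gnb_distributed X nu c m -> (forall j, 0 <= f j) ->
  Q.[0] = 0 ->
  (forall j : nat, weight B c j.+1 * Q.[j.+1%:R] - weight B c j * Q.[j%:R] =
    (f j - l) * (weight B c j * (meixner B c m).[j%:R] ^+ 2)) ->
  ('E_P[fun t => f (X t)] = l%:E)%E.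
Proof.
move=> B B1 c01 Xp f0 Q0 QE; have B0 := lt_le_trans ltr01 B1.
have /andP[c0 c1] := c01.
apply: (expectation_nat_cvg Xp f0).
pose K := rising B m * c ^+ m * (1 - c) `^ B / m`!%:R.
apply: (@cvg_sum_telescoping _ (fun n => K * (weight B c n * Q.[n%:R]))).
- by rewrite Q0 !mulr0.
- by have h := cvgM (cvg_cst K) (cvg_weight_poly Q B0 c01); rewrite mulr0 in h; exact: h.
- move=> j; rewrite -mulrBr QE (gnb_pmf_meixner j B0 (lt0r_neq0 c0)) -/B -/K.
  + by ring.
  + by move=> k; exact: Gamma_rising.
  + by rewrite gt_eqF // Gamma_gt0.
- exact: cvg_sum_pmf Xp.
Qed.

Lemma gnb_expectation_tau0 d (T : measurableType d) (R : realType)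
    (P : probability T R) (X : {RV P >-> nat}) (nu : R) (m : nat)
    (f : nat -> R) : gnb_distributed X nu 0 m -> (forall j, 0 <= f j) ->
  ('E_P[fun t => f (X t)] = (f m)%:E)%E.
Proof.
move=> Xp f0; apply: (expectation_nat_cvg Xp f0).
apply: (@cvg_sum_telescoping _ (fun=> 0)) => //.
- exact: cvg_cst.
- move=> j; rewrite subrr; have [->|jm] := eqVneq j m; first by rewrite subrr mul0r.
  by rewrite gnb_pmf_tau0 // mulr0.
- exact: cvg_sum_pmf Xp.
Qed.

Lemma gnb_moments d (T : measurableType d) (R : realType)
    (P : probability T R) (X : {RV P >-> nat}) (nu c : R) (m : nat) :
  let B := 2 * nu - 2 * m%:R in
  1 <= B -> 0 <= c < 1 -> gnb_distributed X nu c m ->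
  let Y : T -> R := fun t => (X t)%:R in
  ('E_P[Y] = (gnb_mean B c m)%:E)%E /\ ('V_P[Y] = (gnb_variance B c m)%:E)%E.
Proof.
move=> B B1 /andP[c_ge0 c1] Xp Y.
have B0 := lt_le_trans ltr01 B1; pose mu := gnb_mean B c m.
suff [EY VY] : ('E_P[Y] = mu%:E)%E /\
    ('E_P[fun t => (((X t)%:R - mu) ^+ 2)%R] = (gnb_variance B c m)%:E)%E.
  split=> //; rewrite /variance covariance.unlock EY /= -VY.
  by congr ('E_P[_])%E; apply/funext => t; rewrite /= expr2.
move: c_ge0; rewrite le_eqVlt => /predU1P[c0|c0].
  have muE : mu = m%:R by rewrite /mu /gnb_mean -c0 mulr0 addr0 subr0 divr1.
  split.
    rewrite muE -c0 in Xp *.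
    by rewrite (gnb_expectation_tau0 (f := fun j => j%:R) Xp).
  rewrite -c0 in Xp; rewrite (gnb_expectation_tau0 (f := fun j => (j%:R - mu) ^+ 2) Xp).
    by rewrite muE subrr expr0n /gnb_variance -c0 !mul0r.
  by move=> j; rewrite sqr_ge0.
have c01 : 0 < c < 1 by rewrite c0.
split.
  have [Q [Q0 QE]] := mean_telescoping m B0 c01.
  by apply: (gnb_cvg_expectation (f := fun j => j%:R) B1 c01 Xp _ Q0).
have [Q [Q0 QE]] := variance_telescoping m B0 c01.
apply: (gnb_cvg_expectation (f := fun j => (j%:R - mu) ^+ 2) B1 c01 Xp _ Q0) => //.
by move=> j; rewrite sqr_ge0.
Qed.

(** The difference of the variance and the mean, multiplied by [(1 - c)^2]. *)
Definition mandel_numerator (R : realType) (B c : R) (m : nat) : R :=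
  (B + m%:R) * c ^+ 2 + 2 * m%:R * (B + m%:R) * c - m%:R.

Lemma fano_subr1E (R : realType) (B c : R) (m : nat) :
  c < 1 -> gnb_mean B c m != 0 ->
  gnb_variance B c m / gnb_mean B c m - 1 =
  mandel_numerator B c m / ((1 - c) ^+ 2 * gnb_mean B c m).
Proof.
move=> c1 mu0; have c1' : 1 - c != 0 by rewrite subr_eq0 gt_eqF.
have [mu muE] : exists mu, gnb_mean B c m = mu by exists (gnb_mean B c m).
rewrite muE in mu0 *; rewrite invfM mulrA; apply: (mulIf mu0).
rewrite mulrBl !divfK // mul1r -muE.
by rewrite /gnb_variance /gnb_mean /mandel_numerator; field.
Qed.

(** The quadratic [mandel_numerator] has positive leading coefficient,
    nonnegative linear coefficient and nonpositive constant term, so that on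
    the half-line it is negative before its single root and positive after. *)
Lemma sg_mandel_numerator (R : realType) (B : R) (m : nat) : 0 < B ->
  exists2 t0, 0 <= t0 & forall c, 0 <= c ->
    Num.sg (mandel_numerator B c m) = Num.sg (c - t0).
Proof.
move=> B0; pose a := B + m%:R; pose b := m%:R * a.
have a0 : 0 < a by rewrite /a ltr_wpDr.
have b0 : 0 <= b by rewrite mulr_ge0 ?ler0n ?(ltW a0).
pose s := Num.sqrt (b ^+ 2 + b); pose t0 := (s - b) / a.
have sE : s ^+ 2 = b ^+ 2 + b by rewrite sqr_sqrtr // addr_ge0 ?sqr_ge0.
have t00 : 0 <= t0.
  rewrite divr_ge0 ?subr_ge0 ?(ltW a0) //.
  by rewrite -(ger0_norm b0) -sqrtr_sqr ler_wsqrtr // lerDl.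
exists t0 => // c c0.
have -> : mandel_numerator B c m = (c - t0) * (a * (c + t0) + 2 * b).
  have -> : mandel_numerator B c m = a * c ^+ 2 + 2 * b * c - b / a.
    by rewrite /b mulfK ?gt_eqF // /mandel_numerator -/a; ring.
  have t0E : a * t0 ^+ 2 + 2 * b * t0 = b / a.
    transitivity ((s ^+ 2 - b ^+ 2) / a); last by rewrite sE addrC addKr.
    by rewrite /t0; field; rewrite gt_eqF.
  by rewrite -t0E; ring.
rewrite sgrM; have [->|ct] := eqVneq c t0; first by rewrite subrr sgr0 mul0r.
rewrite [X in _ * X]gtr0_sg ?mulr1 //.
apply: ltr_wpDr; first by rewrite mulr_ge0.
rewrite mulr_gt0 // lt_def addr_ge0 // andbT paddr_eq0 //; apply: contra ct.
by move=> /andP[/eqP-> /eqP->].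
Qed.

Theorem proposition3 (R : realType) (nu : R) (m : nat)
    (hnu : 2^-1 < nu) (hm : m%:Z <= Num.floor (nu - 2^-1)) :
  exists2 rho : R, 0 <= rho &
    forall (z : R[i]), Normc.normc z < 1 ->
    forall (d : measure_display) (T : measurableType d) (P : probability T R)
      (X : {RV P >-> nat}),
    gnb_distributed X nu (Normc.normc z ^+ 2) m ->
    let Y : T -> R := fun t => (X t)%:R in
    ('E_P[Y] != 0)%E ->
    [/\ ('V_P[Y] < +oo)%E,
        Normc.normc z < rho -> mandel P Y < 0,
        Normc.normc z = rho -> mandel P Y = 0
      & rho < Normc.normc z -> 0 < mandel P Y].
Proof.
have B1 : 1 <= 2 * nu - 2 * m%:R.
  move: hm; rewrite floor_ge_int => h.
  by have {h} : m%:R <= nu - 2^-1 by []; lra.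
have B0 := lt_le_trans ltr01 B1.
have [t0 t00 sgE] := sg_mandel_numerator m B0.
exists (Num.sqrt t0); first exact: sqrtr_ge0.
move=> z; have z0 : 0 <= Normc.normc z by case: z => a b; exact: sqrtr_ge0.
move: (Normc.normc z) z0 => r r0 r1 d T P X Xp Y EY0.
have c0 : 0 <= r ^+ 2 by exact: sqr_ge0.
have c1 : r ^+ 2 < 1 by rewrite exprn_ilt1.
have [EY VY] := gnb_moments B1 (introT andP (conj c0 c1)) Xp.
rewrite -/Y in EY VY.
have mu0 : gnb_mean (2 * nu - 2 * m%:R) (r ^+ 2) m != 0.
  by move: EY0; rewrite EY.
have mu_gt0 : 0 < gnb_mean (2 * nu - 2 * m%:R) (r ^+ 2) m.
  rewrite lt_def mu0 divr_ge0 ?subr_ge0 ?(ltW c1) //.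
  by rewrite addr_ge0 // mulr_ge0 // addr_ge0 // ltW.
have sgQ : Num.sg (mandel P Y) = Num.sg (r ^+ 2 - t0).
  rewrite /mandel EY VY /= fano_subr1E // sgrM sgE // [X in _ * X]gtr0_sg ?mulr1 //.
  by rewrite invr_gt0 mulr_gt0 // exprn_gt0 // subr_gt0.
have rho0 := sqrtr_ge0 t0.
split; first by rewrite VY ltry.
- move=> lt_r; rewrite -sgr_lt0 sgQ sgr_lt0 subr_lt0 -(sqr_sqrtr t00).
  by rewrite ltr_pXn2r ?nnegrE.
- move=> eq_r; apply/eqP.
  by rewrite -sgr_eq0 sgQ sgr_eq0 eq_r sqr_sqrtr // subrr.
- move=> lt_r; rewrite -sgr_gt0 sgQ sgr_gt0 subr_gt0 -(sqr_sqrtr t00).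
  by rewrite ltr_pXn2r ?nnegrE.
Qed.
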